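(* Let $R$ be a $\mathbb{U}_{\mathrm{opt}}$-LL eDCTRS over a signature $\mathcal{F}$ which is non-LV or non-RV. Then $\mathbb{U}_{\mathrm{opt}}$ is sound for $R$ with respect to EV-safe reduction, i.e., for all $s,t\in T(\mathcal{F},\mathcal{V})$, if $s\to^*_{\mathrm{evs},\mathbb{U}_{\mathrm{opt}}(R)}t$ then $s\to^*_Rt$.
   Context: Terms $T(\mathcal{F},\mathcal{V})$, $\mathrm{Var}(\cdot)$ variables occurring, $\mathrm{Pos}_{\mathcal{F}}(t)$/$\mathrm{Pos}_{\mathcal{V}}(t)$ function-symbol/variable positions, $t|_p$ subterm, $p\le q$ prefix order; linear term: no variable twice. Extended conditional rule $\rho: l\to r\Leftarrow s_1\twoheadrightarrow t_1;\dots;s_k\twoheadrightarrow t_k$ ($l$ may be a variable); eCTRS = set of such rules with rewrite relation $\to_R=\bigcup_n\to_{(n),R}$, $\to_{(0),R}=\emptyset$, $\to_{(i+1),R}=\{(C[l\sigma],C[r\sigma])\mid s_j\sigma\to^*_{(i),R}t_j\sigma\ \forall j\}$; eTRS: unconditional rules only (extra variables allowed). Deterministic: $\mathrm{Var}(s_i)\subseteq\mathrm{Var}(l,t_1,\dots,t_{i-1})$; eDCTRS: all rules deterministic (extra variables in $r$ allowed). Non-LV: $l\notin\mathcal{V}$; non-RV: $r\notin\mathcal{V}$; a rule set has a property if all rules do. Optimized unraveling: for $k\ge1$, $X_i=\mathrm{Var}(l,t_1,\dots,t_{i-1})$, $Y_i=\mathrm{Var}(r,t_i,s_{i+1},t_{i+1},\dots,s_k,t_k)$,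 $Z_i=X_i\cap Y_i$, $\overrightarrow{X}$ a fixed listing of a finite set $X$, fresh $U^\rho_1,\dots,U^\rho_k$; $\mathbb{U}_{\mathrm{opt}}(\rho)=\{l\to U^\rho_1(s_1,\overrightarrow{Z_1})\}\cup\{U^\rho_i(t_i,\overrightarrow{Z_i})\to U^\rho_{i+1}(s_{i+1},\overrightarrow{Z_{i+1}})\mid1\le i<k\}\cup\{U^\rho_k(t_k,\overrightarrow{Z_k})\to r\}$, unconditional rules kept, $\mathbb{U}_{\mathrm{opt}}(R)$ the union. $R$ is $\mathbb{U}_{\mathrm{opt}}$-LL if every rule of $\mathbb{U}_{\mathrm{opt}}(R)$ has a linear left-hand side. EV-safe reduction of an eTRS $S$: for $t_0\to_{p_1,l_1\to r_1}t_1\to_{p_2,l_2\to r_2}\cdots$ put $B_0=\mathrm{Pos}_{\mathcal{F}}(t_0)$, $B_i=(B_{i-1}\setminus\{q\in B_{i-1}\mid q\ge p_i\})\cup\{p_iq\mid q\in\mathrm{Pos}_{\mathcal{F}}(r_i)\}\cup\{p_ip'q\mid p_ipq\in B_{i-1},p\in\mathrm{Pos}_{\mathcal{V}}(l_i),l_i|_p=r_i|_{p'}\}$; the sequence is EV-safe if $p_i\in B_{i-1}$ for all $i$; $s\to^*_{\mathrm{evs},S}t$ if a finite EV-safe sequence from $s$ to $t$ exists. *)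

(* Defs.v *)
From Stdlib Require List.
From Stdlib Require Import Relations.
From mathcomp Require Import all_boot finmap.

Set Implicit Arguments.
Unset Strict Implicit.
Unset Printing Implicit Defensive.

Local Open Scope fset_scope.

(* [term F V] imposes no arities; T(F, V) for a given signature is carved out
   by [term_over].  A signature is a set of pairs (symbol, arity). *)
Inductive term (F V : Type) : Type :=
| Var (x : V)
| App (f : F) (ts : seq (term F V)).
Arguments Var {F V} x.
Arguments App {F V} f ts.

Inductive ctx (F V : Type) : Type :=
| Hole
| CApp (f : F) (us : seq (term F V)) (C : ctx F V) (vs : seq (term F V)).
Arguments Hole {F V}.
Arguments CApp {F V} f us C vs.

Definition signature (F : Type) := F -> nat -> Prop.

Section Terms.
Variables (F V : Type).
Implicit Types (t u : term F V) (C : ctx F V) (sigma : V -> term F V).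

Fixpoint term_over (sg : signature F) t : Prop :=
  match t with
  | Var _ => True
  | App f ts =>
      sg f (size ts) /\ foldr (fun u P => term_over sg u /\ P) True ts
  end.

Fixpoint ctx_over (sg : signature F) C : Prop :=
  match C with
  | Hole => True
  | CApp f us C vs =>
      [/\ sg f (size us + size vs).+1,
          List.Forall (term_over sg) us,
          ctx_over sg C &
          List.Forall (term_over sg) vs]
  end.

Definition subst_over (sg : signature F) sigma : Prop :=
  forall x, term_over sg (sigma x).

Fixpoint fill C t : term F V :=
  match C with
  | Hole => t
  | CApp f us C vs => App f (us ++ fill C t :: vs)
  end.

Fixpoint subst sigma t : term F V :=
  match t with
  | Var x => sigma x
  | App f ts => App f (map (subst sigma) ts)
  end.

Fixpoint vars t : seq V :=
  match t with
  | Var x => [:: x]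
  | App _ ts => flatten (map vars ts)
  end.

Definition is_var t : bool := if t is Var _ then true else false.

(* Positions number the arguments of a symbol from 0. *)
Definition position := seq nat.

Fixpoint hole_pos C : position :=
  match C with
  | Hole => [::]
  | CApp _ us C _ => size us :: hole_pos C
  end.

Fixpoint subterm t (p : position) : option (term F V) :=
  match p, t with
  | [::], _ => Some t
  | i :: p', App _ ts => obind (fun u => subterm u p') (onth ts i)
  | _ :: _, Var _ => None
  end.

Definition fpos t (p : position) : Prop :=
  exists f ts, subterm t p = Some (App f ts).

Definition vpos t (p : position) : Prop :=
  exists x, subterm t p = Some (Var x).

End Terms.

Definition linear (F : Type) (V : eqType) (t : term F V) : bool :=
  uniq (vars t).

(* The conditional rule  lhs -> rhs <= s_1 ->> t_1; ...; s_k ->> t_k  has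
   conds = [:: (s_1, t_1); ...; (s_k, t_k)]; it is unconditional if k = 0. *)
Record erule (F V : Type) : Type := Rule {
  lhs : term F V;
  rhs : term F V;
  conds : seq (term F V * term F V)
}.
Arguments Rule {F V} lhs rhs conds.

Definition eCTRS (F V : Type) := erule F V -> Prop.

Section ConditionalRewriting.
Variables (F V : Type) (sg : signature F) (R : eCTRS F V).
Implicit Types (rho : erule F V) (s t : term F V).

Definition rule_over rho : Prop :=
  [/\ term_over sg (lhs rho), term_over sg (rhs rho) &
      List.Forall (fun c => term_over sg c.1 /\ term_over sg c.2) (conds rho)].

Definition eCTRS_over : Prop := forall rho, R rho -> rule_over rho.

Definition nonLV : Prop := forall rho, R rho -> ~~ is_var (lhs rho).

Definition nonRV : Prop := forall rho, R rho -> ~~ is_var (rhs rho).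

Fixpoint rstep_level (n : nat) : relation (term F V) :=
  match n with
  | 0 => fun _ _ => False
  | m.+1 => fun s t =>
      exists rho C sigma,
        [/\ R rho, ctx_over sg C /\ subst_over sg sigma,
            List.Forall
              (fun c => clos_refl_trans _ (rstep_level m)
                          (subst sigma c.1) (subst sigma c.2))
              (conds rho),
            s = fill C (subst sigma (lhs rho)) &
            t = fill C (subst sigma (rhs rho))]
  end.

Definition rstep : relation (term F V) :=
  fun s t => exists n, rstep_level n s t.

Definition rsteps : relation (term F V) := clos_refl_trans _ rstep.

End ConditionalRewriting.

Section EVSafe.
Variables (F V : Type) (sg : signature F) (S : eCTRS F V).
Implicit Types (s t l r : term F V) (B : position -> Prop).

(* B_i, given B = B_(i-1) and a step at position p by the rule l -> r. *)
Definition ev_update B (p : position) l r : position -> Prop := fun q =>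
  [\/ B q /\ ~~ prefix p q,
      exists2 q', fpos r q' & q = p ++ q' |
      exists pl pr q',
        [/\ vpos l pl, subterm l pl = subterm r pr,
            B (p ++ pl ++ q') & q = p ++ pr ++ q']].

Inductive evs_from : (position -> Prop) -> term F V -> term F V -> Prop :=
| evs_refl B t : evs_from B t t
| evs_step B l r C sigma t :
    S (Rule l r [::]) -> ctx_over sg C -> subst_over sg sigma ->
    B (hole_pos C) ->
    evs_from (ev_update B (hole_pos C) l r) (fill C (subst sigma r)) t ->
    evs_from B (fill C (subst sigma l)) t.

Definition evsteps s t : Prop := evs_from (fpos s) s t.

End EVSafe.

(* [inr (rho, i)] is the fresh symbol U^rho_i, 1 <= i <= k. *)
Definition usym (F V : Type) : Type := (F + erule F V * nat)%type.

Fixpoint emb (F V : Type) (t : term F V) : term (usym F V) V :=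
  match t with
  | Var x => Var x
  | App f ts => App (inl f) (map (@emb F V) ts)
  end.

Section Unraveling.
Variables (F : Type) (V : choiceType).
Implicit Types (rho : erule F V) (i : nat) (t : term F V).

(* s_i and t_i, for 1 <= i <= k; the default value of [nth] is irrelevant. *)
Definition cond_l rho i : term F V :=
  (nth (lhs rho, rhs rho) (conds rho) i.-1).1.
Definition cond_r rho i : term F V :=
  (nth (lhs rho, rhs rho) (conds rho) i.-1).2.

Definition Vars (ts : seq (term F V)) : {fset V} :=
  [fset x in flatten (map (@vars F V) ts)].

Definition Xset rho i : {fset V} :=
  Vars (lhs rho :: [seq c.2 | c <- take i.-1 (conds rho)]).

Definition Yset rho i : {fset V} :=
  Vars (rhs rho :: cond_r rho i ::
        flatten [seq [:: c.1; c.2] | c <- drop i (conds rho)]).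

Definition Zset rho i : {fset V} := Xset rho i `&` Yset rho i.

Definition deterministic_rule rho : Prop :=
  forall i, 1 <= i <= size (conds rho) ->
    Vars [:: cond_l rho i] `<=` Xset rho i.

Definition deterministic (R : eCTRS F V) : Prop :=
  forall rho, R rho -> deterministic_rule rho.

Definition is_listing (lst : {fset V} -> seq V) : Prop :=
  forall X : {fset V}, uniq (lst X) /\ lst X =i X.

Variable lst : {fset V} -> seq V.

Definition uterm rho i t : term (usym F V) V :=
  App (inr (rho, i)) (emb t :: [seq Var x | x <- lst (Zset rho i)]).

Inductive Uopt_rule rho : eCTRS (usym F V) V :=
| Uopt_uncond :
    size (conds rho) = 0 ->
    Uopt_rule rho (Rule (emb (lhs rho)) (emb (rhs rho)) [::])
| Uopt_first :
    1 <= size (conds rho) ->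
    Uopt_rule rho (Rule (emb (lhs rho)) (uterm rho 1 (cond_l rho 1)) [::])
| Uopt_next i :
    1 <= i < size (conds rho) ->
    Uopt_rule rho (Rule (uterm rho i (cond_r rho i))
                        (uterm rho i.+1 (cond_l rho i.+1)) [::])
| Uopt_last :
    1 <= size (conds rho) ->
    Uopt_rule rho
      (Rule (uterm rho (size (conds rho)) (cond_r rho (size (conds rho))))
            (emb (rhs rho)) [::]).

Definition Uopt (R : eCTRS F V) : eCTRS (usym F V) V :=
  fun r => exists2 rho, R rho & Uopt_rule rho r.

Definition Uopt_LL (R : eCTRS F V) : Prop :=
  forall r, Uopt R r -> linear (lhs r).

Definition Uopt_sig (sg : signature F) (R : eCTRS F V) :
    signature (usym F V) := fun g n =>
  match g with
  | inl f => sg f n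
  | inr (rho, i) =>
      [/\ R rho, 1 <= i <= size (conds rho) & n = (size (lst (Zset rho i))).+1]
  end.

End Unraveling.

Definition arity_sig (F : Type) (ar : F -> nat) : signature F :=
  fun f n => n = ar f.

(* Main.v *)
From Stdlib Require List.
From Stdlib Require Import Relations.
Require Import Defs.
From mathcomp Require Import all_boot finmap.

Set Implicit Arguments.
Unset Strict Implicit.
Unset Printing Implicit Defensive.

(* Every term u reachable from s by an EV-safe reduction is simulated by s: s
   reduces over R to what u stands for.  A subterm U^rho_i(u, us) stands for an
   instance l sigma of the left-hand side of rho whose first i - 1 conditions
   have been established, such that s_i sigma and the instances of the
   variables in Z_i simulate the arguments.  As sigma keeps the values the
   variables had when they were first matched, it serves for l, for all
   conditions and for r at once, even though the arguments of U^rho_i evolve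
   independently afterwards; linearity of U^rho_i(t_i, Z_i) guarantees that the
   matching against t_i binds only new variables.  Instances of extra variables
   may contain U symbols, but these are never redexes by EV-safety and never
   inside a match, as U symbols occur in left-hand sides only at the root. *)

(** * Finite choice and lists *)

Lemma finite_choice (T : Type) (d : T) (P : nat -> T -> Prop) n :
  (forall i, i < n -> exists x, P i x) ->
  exists f, forall i, i < n -> P i (f i).
Proof.
elim: n => [|n IHn] Pex; first by exists (fun _ => d).
have [i /leqW lt_in|f fP] := IHn; first exact: Pex.
have [x Px] := Pex n (ltnSn n).
exists (fun i => if i == n then x else f i) => i.
rewrite ltnS leq_eqVlt; case: eqVneq => [->|_] //=; exact: fP.
Qed.

Lemma Forall_onth (T : Type) (P : T -> Prop) (s : seq T) :
  List.Forall P s <-> forall i x, onth s i = Some x -> P x.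
Proof.
split=> [|Ps].
  by elim=> [|y s' Py _ IHs] [|i] x //=; [case=> <- | apply: IHs].
elim: s Ps => [|y s' IHs] Ps; first exact: List.Forall_nil.
apply: List.Forall_cons; first exact: (Ps 0).
by apply: IHs => i; apply: (Ps i.+1).
Qed.

(** * Induction and substitution on terms *)

Section TermFacts.
Variables (F V : Type).
Implicit Types (t : term F V) (sigma : V -> term F V).

(** The generated principle gives no hypothesis for arguments nested in a list. Indexing by [onth]
    lets them be followed in step with another list. *)
Lemma term_induction (P : term F V -> Prop) :
    (forall x, P (Var x)) ->
    (forall f ts, (forall i u, onth ts i = Some u -> P u) -> P (App f ts)) ->
  forall t, P t.
Proof.
move=> PV PA; fix IHt 1 => -[x|f ts]; first exact: PV.
apply: PA; elim: ts => [|t ts IHts] [|i] u /=; [discriminate | discriminate | | exact: IHts].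
by case=> <-; apply: IHt.
Qed.

Lemma term_over_App (sg : signature F) f (ts : seq (term F V)) :
  term_over sg (App f ts) <->
  sg f (size ts) /\ forall i u, onth ts i = Some u -> term_over sg u.
Proof.
rewrite -Forall_onth /=; split=> -[Hf Hts]; split=> //; move: Hts.
  by elim: ts {Hf} => [|u ts IHts] /=; [left | case=> ? ?; right; auto].
by elim=> [|u ts' Hu _ IHts] /=.
Qed.

Lemma subst_over_term (sg : signature F) sigma t :
  subst_over sg sigma -> term_over sg t -> term_over sg (subst sigma t).
Proof.
move=> sigma_ov; elim/term_induction: t => [x _|f ts IHts]; first exact: sigma_ov.
case/term_over_App=> Hf Hts; apply/term_over_App; rewrite size_map; split=> // i u.
rewrite onth_map; case E: onth => [v|] //= -[<-].
exact: IHts E (Hts _ _ E).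
Qed.

End TermFacts.

(** * Variables and linear terms *)

Section TermVariables.
Variables (F : Type) (V : eqType).
Implicit Types (t : term F V) (sigma tau : V -> term F V).


Lemma mem_flatten_vars (ts : seq (term F V)) x :
  x \in flatten (map (@vars F V) ts) <->
  exists i t, onth ts i = Some t /\ x \in vars t.
Proof.
elim: ts => [|t ts IHts] /=; first by split=> // -[[|i] [u []]].
rewrite mem_cat; split=> [/orP[xt|/IHts[i [u Hu]]]|[[|i] [u [/= Hu xu]]]].
- by exists 0, t.
- by exists i.+1, u.
- by case: Hu => ->; rewrite xu.
- by apply/orP; right; apply/IHts; exists i, u.
Qed.

Lemma mem_vars t x :
  x \in vars t <-> exists p, subterm t p = Some (Var x).
Proof.
elim/term_induction: t => [y|f ts IHts] /=.
  rewrite inE; split=> [/eqP->|[[|i p] //= [->]]] //; first by exists [::].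
rewrite mem_flatten_vars; split=> [[i [t [Ht /(IHts _ _ Ht)[p Hp]]]]|[[|i p] //=]].
  by exists (i :: p); rewrite /= Ht.
case Ht: onth => [t|] //= Hp; exists i, t; split=> //.
by apply/(IHts _ _ Ht); exists p.
Qed.

Lemma eq_subst_vars sigma tau t :
  {in vars t, sigma =1 tau} -> subst sigma t = subst tau t.
Proof.
elim/term_induction: t => [x|f ts IHts] /= eq_st; first by apply: eq_st; rewrite inE.
congr App; apply: eq_from_onth => i; rewrite !onth_map.
case E: onth => [u|] //=; congr Some; apply: (IHts _ _ E) => x xu.
by apply: eq_st; apply/mem_flatten_vars; exists i, u.
Qed.

Lemma uniq_flatten_vars_inj (ts : seq (term F V)) i j t u x :
    uniq (flatten (map (@vars F V) ts)) ->
    onth ts i = Some t -> onth ts j = Some u ->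
  x \in vars t -> x \in vars u -> i = j.
Proof.
elim: ts i j => [|t0 ts IHts] [|i] [|j] //=; rewrite cat_uniq => /and3P[_ disj Uts].
- case=> <- Hu xt xu; case/hasP: disj; exists x => //.
  by apply/mem_flatten_vars; exists j, u.
- move=> Ht [<-] xt xu; case/hasP: disj; exists x => //.
  by apply/mem_flatten_vars; exists i, t.
- by move=> Ht Hu xt xu; congr _.+1; apply: IHts Ht Hu xt xu.
Qed.

Lemma uniq_flatten_vars_onth (ts : seq (term F V)) i t :
  uniq (flatten (map (@vars F V) ts)) -> onth ts i = Some t -> uniq (vars t).
Proof.
elim: ts i => [|t0 ts IHts] [|i] //=; rewrite cat_uniq => /and3P[Ut _ Uts].
  by case=> <-.
exact: IHts.
Qed.

Lemma linear_var_pos_inj t p q x : linear t ->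
  subterm t p = Some (Var x) -> subterm t q = Some (Var x) -> p = q.
Proof.
rewrite /linear; elim/term_induction: t p q => [y|f ts IHts] [|i p] [|j q] //= Uts.
case Ei: onth => [t|] //= Hp; case Ej: onth => [u|] //= Hq.
have eq_ij : i = j.
  have xt : x \in vars t by apply/mem_vars; exists p.
  have xu : x \in vars u by apply/mem_vars; exists q.
  exact: uniq_flatten_vars_inj Uts Ei Ej xt xu.
move: Ej; rewrite -eq_ij Ei => -[eq_tu]; rewrite -eq_tu in Hq; congr cons.
apply: (IHts _ _ Ei) Hp Hq; exact: uniq_flatten_vars_onth Ei.
Qed.

End TermVariables.

(** * Positions of variables *)

Section VariablePositions.
Variables (F V : Type).
Implicit Types t : term F V.

Lemma subterm_var_cat t p q x u :
  subterm t p = Some (Var x) -> subterm t (p ++ q) = Some u ->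
  q = [::] /\ u = Var x.
Proof.
elim: p t => [|i p IHp] [y|f ts] //=.
  by case=> ->; case: q => [|j q] //= [].
by case: onth => //= v; apply: IHp.
Qed.

(** Variables are leaves, so a position factors through at most one variable position. *)
Lemma var_pos_cat_inj t p1 p2 q1 q2 x1 x2 :
  subterm t p1 = Some (Var x1) -> subterm t p2 = Some (Var x2) ->
  p1 ++ q1 = p2 ++ q2 -> p1 = p2 /\ q1 = q2.
Proof.
elim: p1 p2 t => [|i p1 IHp] [|j p2] [y|f ts] //=.
move=> H1 H2 [eq_ij eq_pq]; move: H1 H2; rewrite -eq_ij.
by case: onth => //= v H1 H2; have [-> ->] := IHp _ _ H1 H2 eq_pq.
Qed.

End VariablePositions.

(** * Conditional rewriting without levels *)

Section RewritingFacts.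
Variables (F V : Type) (sg : signature F) (R : eCTRS F V).
Implicit Types (s t u v : term F V) (rho : erule F V).

Lemma clos_rt_mono (T : Type) (r1 r2 : relation T) :
    (forall x y, r1 x y -> r2 x y) ->
  forall x y, clos_refl_trans T r1 x y -> clos_refl_trans T r2 x y.
Proof.
move=> r12 x y; elim=> [x' y' /r12|x'|x' y' z' _ IH1 _ IH2]; first exact: rt_step.
  exact: rt_refl.
exact: rt_trans IH1 IH2.
Qed.

Lemma rstep_level_mono m n s t :
  m <= n -> rstep_level sg R m s t -> rstep_level sg R n s t.
Proof.
elim: m n s t => [|m IHm] [|n] //= s t le_mn [rho [C [sigma [Rrho ov cs -> ->]]]].
exists rho, C, sigma; split=> //; apply: List.Forall_impl cs => c.
by apply: clos_rt_mono => x y; apply: IHm.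
Qed.

Lemma rsteps_level s t :
  rsteps sg R s t -> exists n, clos_refl_trans _ (rstep_level sg R n) s t.
Proof.
elim=> [x y [n Hn]|x|x y z _ [m Hm] _ [n Hn]]; first by exists n; apply: rt_step.
  by exists 0; apply: rt_refl.
exists (maxn m n); apply: rt_trans (_ : clos_refl_trans _ _ x y) _.
  by apply: clos_rt_mono Hm => a b; apply: rstep_level_mono; apply: leq_maxl.
by apply: clos_rt_mono Hn => a b; apply: rstep_level_mono; apply: leq_maxr.
Qed.

(** The conditions are finitely many finite reductions, so a single level bounds them all. This
    hides the levels from the simulation argument. *)
Lemma rsteps_rule rho (sigma : V -> term F V) :
    R rho -> subst_over sg sigma ->
    List.Forall (fun c => rsteps sg R (subst sigma c.1) (subst sigma c.2))
      (conds rho) ->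
  rsteps sg R (subst sigma (lhs rho)) (subst sigma (rhs rho)).
Proof.
move=> Rrho ov cs; apply: rt_step.
suff [n Hn] : exists n, List.Forall (fun c => clos_refl_trans _
    (rstep_level sg R n) (subst sigma c.1) (subst sigma c.2)) (conds rho).
  by exists n.+1, rho, Hole, sigma.
elim: cs => [|c cs' /rsteps_level[m Hm] _ [n Hn]]; first by exists 0.
exists (maxn m n); apply: List.Forall_cons.
  by apply: clos_rt_mono Hm => a b; apply: rstep_level_mono; apply: leq_maxl.
apply: List.Forall_impl Hn => d.
by apply: clos_rt_mono => a b; apply: rstep_level_mono; apply: leq_maxr.
Qed.

Lemma rsteps_arg f us vs s t :
    sg f (size us + size vs).+1 ->
    List.Forall (term_over sg) us -> List.Forall (term_over sg) vs ->
  rsteps sg R s t -> rsteps sg R (App f (us ++ s :: vs)) (App f (us ++ t :: vs)).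
Proof.
move=> Hf Hus Hvs; elim=> [x y [[|n] //= Hxy]|x|x y z _ IH1 _ IH2].
- case: Hxy => rho [C [sigma [Rrho [C_ov ov] cs -> ->]]].
  by apply: rt_step; exists n.+1, rho, (CApp f us C vs), sigma; split.
- exact: rt_refl.
- exact: rt_trans IH1 IH2.
Qed.

Lemma rsteps_App f us vs :
    term_over sg (App f us) -> size us = size vs ->
    (forall i u v, onth us i = Some u -> onth vs i = Some v ->
      rsteps sg R u v /\ term_over sg v) ->
  rsteps sg R (App f us) (App f vs).
Proof.
case/term_over_App=> Hf /Forall_onth Hus.
(* [pre] collects the arguments already rewritten, from left to right; the reducts must lie over
   [sg] since they join the context of later steps. *)
suff gen : forall pre, sg f (size pre + size us) ->
    List.Forall (term_over sg) pre -> size us = size vs ->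
    (forall i u v, onth us i = Some u -> onth vs i = Some v ->
      rsteps sg R u v /\ term_over sg v) ->
    rsteps sg R (App f (pre ++ us)) (App f (pre ++ vs)).
  exact: (gen [::]).
elim: us vs Hus {Hf} => [|u us IHus] [|v vs] //= Hus pre Hf Hpre.
  by move=> _ _; apply: rt_refl.
case=> eq_sz Huv; have [Hu Hv] := Huv 0 u v erefl erefl.
case/List.Forall_cons_iff: Hus => u_ov us_ov.
apply: (@rt_trans _ _ _ (App f (pre ++ v :: us))).
  by apply: rsteps_arg => //; rewrite -addnS.
rewrite -!cat_rcons; apply: IHus => //.
- by rewrite size_rcons addSn -addnS.
- by rewrite -cats1; apply/List.Forall_app; split=> //; apply: List.Forall_cons.
- by move=> i; apply: (Huv i.+1).
Qed.

End RewritingFacts.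

(** * Embedding into the extended signature, and erasure *)

Section Embedding.
Variables (F V : Type).
Implicit Types (t : term F V) (sigma : V -> term (usym F V) V).

Lemma subterm_emb_var t p x :
  subterm (emb t) p = Some (Var x) <-> subterm t p = Some (Var x).
Proof.
elim/term_induction: t p => [y|f ts IHts] [|i p] //=; first by split=> [] [->].
by rewrite onth_map; case E: onth => [t|] //=; apply: IHts E _.
Qed.

(* Applied only to instances of extra variables and their subterms; their
   [U]-rooted subterms are never matched, so any term over F may replace them. *)
Fixpoint erase (x0 : V) (u : term (usym F V) V) : term F V :=
  match u with
  | Var x => Var x
  | App (inl f) us => App f (map (erase x0) us)
  | App (inr _) _ => Var x0
  end.

(** An embedded term has no [U] symbols, so erasure acts only inside the substitution. *)
Lemma erase_subst_emb x0 sigma t :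
  erase x0 (subst sigma (emb t)) = subst (erase x0 \o sigma) t.
Proof.
elim/term_induction: t => [x|f ts IHts] //=; congr App.
apply: eq_from_onth => i; rewrite !onth_map.
by case E: onth => [t|] //=; rewrite (IHts _ _ E).
Qed.

Lemma erase_emb x0 t : erase x0 (emb t) = t.
Proof.
elim/term_induction: t => [x|f ts IHts] //=; congr App.
apply: eq_from_onth => i; rewrite !onth_map.
by case E: onth => [t|] //=; rewrite (IHts _ _ E).
Qed.

Lemma term_over_erase x0 (sg : signature F) (usg : signature (usym F V)) u :
  (forall f n, usg (inl f) n -> sg f n) ->
  term_over usg u -> term_over sg (erase x0 u).
Proof.
move=> sub_sg; elim/term_induction: u => [x|[f|//] us IHus] //.
case/term_over_App=> Hf Hus; apply/term_over_App; rewrite size_map.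
split=> [|i u]; first exact: sub_sg.
rewrite onth_map; case E: onth => [v|] //= -[<-].
exact: (IHus _ _ E) (Hus _ _ E).
Qed.

End Embedding.

Lemma vars_emb (F : Type) (V : eqType) (t : term F V) : vars (emb t) = vars t.
Proof.
elim/term_induction: t => [x|f ts IHts] //=; congr flatten.
apply: eq_from_onth => i; rewrite !onth_map.
by case E: onth => [t|] //=; rewrite (IHts _ _ E).
Qed.

(** * The variable sets X_i and Y_i of a rule *)

Section RuleVariables.
Variables (F : Type) (V : choiceType).
Implicit Types (rho : erule F V) (i j : nat).

Lemma mem_Vars (ts : seq (term F V)) x :
  (x \in Vars ts) = (x \in flatten (map (@vars F V) ts)).
Proof. by rewrite /Vars !inE. Qed.

(** [cond_l] and [cond_r] number the conditions from 1, [onth] from 0. *)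
Lemma cond_onth rho i : i < size (conds rho) ->
  onth (conds rho) i = Some (cond_l rho i.+1, cond_r rho i.+1).
Proof.
rewrite -onthTE /cond_l /cond_r /=; case E: onth => [c|] // _.
by rewrite (onth_nth _ _ _ _ E); case: c {E}.
Qed.

Lemma Forall_conds rho (P : term F V -> term F V -> Prop) :
    (forall j, 1 <= j <= size (conds rho) -> P (cond_l rho j) (cond_r rho j)) ->
  List.Forall (fun c => P c.1 c.2) (conds rho).
Proof.
move=> HP; apply/Forall_onth => i c Hc.
have lt_i : i < size (conds rho) by rewrite -onthTE Hc.
by move: Hc; rewrite cond_onth // => -[<-]; apply: HP.
Qed.

Lemma lhs_Xset rho i x : x \in vars (lhs rho) -> x \in Xset rho i.
Proof. by rewrite mem_Vars /= mem_cat => ->. Qed.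

Lemma cond_r_Xset rho i j x : 1 <= j < i -> i <= size (conds rho) ->
  x \in vars (cond_r rho j) -> x \in Xset rho i.
Proof.
case: j => [|j] //; case: i => [|i] //= lt_ji lt_i xj.
rewrite mem_Vars /= mem_cat; apply/orP; right; apply/mem_flatten_vars.
exists j, (cond_r rho j.+1); split=> //.
rewrite onth_map onthE map_take nth_take // -onthE cond_onth //.
exact: ltn_trans (_ : j < i) lt_i.
Qed.

Lemma Xset_sub rho i j x : j <= i -> x \in Xset rho j -> x \in Xset rho i.
Proof.
move=> le_ji; rewrite !mem_Vars /= !mem_cat => /orP[-> //|xj]; apply/orP; right.
have le_ji1 : j.-1 <= i.-1 by rewrite -!subn1 leq_sub2r.
rewrite -(cat_take_drop j.-1 (take i.-1 _)) take_takel //.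
by rewrite map_cat map_cat flatten_cat mem_cat xj.
Qed.

Lemma rhs_Yset rho i x : x \in vars (rhs rho) -> x \in Yset rho i.
Proof. by rewrite mem_Vars /= mem_cat => ->. Qed.

Lemma cond_r_Yset rho i x : x \in vars (cond_r rho i) -> x \in Yset rho i.
Proof. by rewrite mem_Vars /= !mem_cat => ->; rewrite orbT. Qed.

(** [drop i] keeps condition i+1 and all later ones. Hence the variables on the right of a rule
    between two [U] symbols lie in Y_i, where being unmatched implies lying outside X_i. *)
Lemma YsetS rho i x : 1 <= i < size (conds rho) ->
  (x \in vars (cond_l rho i.+1)) || (x \in Yset rho i.+1) -> x \in Yset rho i.
Proof.
case/andP=> _ lt_i; rewrite !mem_Vars /= (drop_nth (lhs rho, rhs rho) lt_i) /=.
by rewrite !mem_cat; do ![case: (x \in _)].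
Qed.

End RuleVariables.

(** * The simulation relation and its closure under contexts *)

Section Soundness.
Variables (F : Type) (V : choiceType) (sg : signature F).
Variables (lst : {fset V} -> seq V) (lst_listing : is_listing lst).
Variables (R : eCTRS F V) (R_over : eCTRS_over sg R).
Variables (R_det : deterministic R) (R_LL : Uopt_LL lst R) (x0 : V).

Local Notation usg := (Uopt_sig lst sg R).
Local Notation rsteps := (rsteps sg R).
Implicit Types (B : position -> Prop) (w : term F V) (u v l r : term (usym F V) V).
Implicit Types (rho : erule F V).

(** The arguments that U^rho_i receives on creation, before instantiation, kept as terms over F so
    that the substitution in [sim_U] applies to them. *)
Definition uargs rho i : seq (term F V) :=
  cond_l rho i :: map Var (lst (Zset rho i)).

(* [B] is the set of positions of [u] at which EV-safety allows a step; an
   instance of an extra variable has none and stands for its erasure. *)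
Inductive simulates : (position -> Prop) -> term F V -> term (usym F V) V -> Prop :=
| sim_extra B w u : (forall q, ~ B q) -> rsteps w (erase x0 u) -> simulates B w u
| sim_Var B w x : rsteps w (Var x) -> simulates B w (Var x)
| sim_App B w f ws us :
    rsteps w (App f ws) -> term_over sg (App f ws) -> size ws = size us ->
    (forall i w' u', onth ws i = Some w' -> onth us i = Some u' ->
      simulates (fun q => B (i :: q)) w' u') ->
    simulates B w (App (inl f) us)
| sim_U B w rho i sigma us :
    R rho -> 1 <= i <= size (conds rho) -> subst_over sg sigma ->
    rsteps w (subst sigma (lhs rho)) ->
    (forall j, 1 <= j < i ->
      rsteps (subst sigma (cond_l rho j)) (subst sigma (cond_r rho j))) ->
    size (uargs rho i) = size us ->
    (forall n w' u', onth (uargs rho i) n = Some w' -> onth us n = Some u' ->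
      simulates (fun q => B (n :: q)) (subst sigma w') u') ->
    simulates B w (App (inr (rho, i)) us).

(** [B] is only ever required to be empty, at extra instances, so shrinking it is harmless. The
    analysis of a step thus has to bound the updated set only from above. *)
Lemma sim_sub B B' w u :
  (forall q, B' q -> B q) -> simulates B w u -> simulates B' w u.
Proof.
move=> subB sim_wu; elim: sim_wu B' subB => {B w u}.
- by move=> B w u B0 wu B' subB; apply: sim_extra => // q /subB/B0.
- by move=> B w x wx B' _; apply: sim_Var.
- move=> B w f ws us wf ov sz _ IH B' subB; apply: (sim_App wf ov sz).
  by move=> i w' u' Hw Hu; apply: IH Hw Hu _ _ => q; apply: subB.
- move=> B w rho i sigma us Rrho Hi ov wl cs sz _ IH B' subB.
  apply: sim_U Rrho Hi ov wl cs sz _ => n w' u' Hw Hu.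
  by apply: IH Hw Hu _ _ => q; apply: subB.
Qed.

Lemma sim_rsteps B w w' u : rsteps w w' -> simulates B w' u -> simulates B w u.
Proof.
move=> ww' sim_wu; case: sim_wu ww' => {B w' u}.
- by move=> B w' u B0 wu ww'; apply: sim_extra => //; apply: rt_trans ww' wu.
- by move=> B w' x wx ww'; apply: sim_Var; apply: rt_trans ww' wx.
- move=> B w' f ws us wf ov sz IH ww'; apply: sim_App ov sz IH.
  exact: rt_trans ww' wf.
- move=> B w' rho i sigma us Rrho Hi ov wl cs sz IH ww'.
  apply: sim_U Rrho Hi ov _ cs sz IH; exact: rt_trans ww' wl.
Qed.

Lemma subst_over_erase sigma :
  subst_over usg sigma -> subst_over sg (erase x0 \o sigma).
Proof. by move=> ov x; apply: term_over_erase (ov x). Qed.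

Lemma term_over_cond rho i : R rho -> 1 <= i <= size (conds rho) ->
  term_over sg (cond_l rho i) /\ term_over sg (cond_r rho i).
Proof.
case: i => // i /R_over[_ _ /Forall_onth cs] /cond_onth E.
exact: (cs _ _ E).
Qed.

Lemma term_over_uargs rho i n w : R rho -> 1 <= i <= size (conds rho) ->
  onth (uargs rho i) n = Some w -> term_over sg w.
Proof.
move=> Rrho Hi; case: n => [[<-]|n]; first by case: (term_over_cond Rrho Hi).
by rewrite /= onth_map; case: onth => //= x -[<-].
Qed.

Lemma ev_update_cons B i p l r q :
  ev_update B (i :: p) l r (i :: q) -> ev_update (fun q => B (i :: q)) p l r q.
Proof.
case=> [[Bq]|[q' rq' [->]]|[pl [pr [q' [lpl lr Bq [->]]]]]].
- by rewrite /= eqxx => npq; constructor 1.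
- by constructor 2; exists q'.
- by constructor 3; exists pl, pr, q'.
Qed.

Lemma ev_update_neq B i p l r j q :
  j != i -> ev_update B (i :: p) l r (j :: q) -> B (j :: q).
Proof.
move/eqP=> ne_ji [[]//|[q' _ [/ne_ji]]//|[pl [pr [q' [_ _ _ [/ne_ji]]]]]//].
Qed.

Lemma onth_update (T : Type) (us vs : seq T) (x y : T) i z :
  onth (us ++ y :: vs) i = Some z ->
  i = size us /\ z = y \/ i != size us /\ onth (us ++ x :: vs) i = Some z.
Proof.
rewrite !onth_cat; case: (ltngtP i (size us)) => [lt_i|gt_i|->].
- by right.
- rewrite -(subnSK gt_i) /=; by right.
- by rewrite subnn => -[->]; left.
Qed.

(** The allowed hole position excludes extra instances along the path, which therefore runs through
    [sim_App] and [sim_U] only. There one argument changes, and its siblings gain no allowed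
    position. *)
Lemma sim_fill l r u v :
    (forall B w, term_over sg w -> B [::] -> simulates B w u ->
      simulates (ev_update B [::] l r) w v) ->
  forall C B w, term_over sg w -> B (hole_pos C) -> simulates B w (fill C u) ->
    simulates (ev_update B (hole_pos C) l r) w (fill C v).
Proof.
move=> root; elim=> [|g us C IHC vs] B w w_ov; first exact: root.
move=> /= BC sim_w.
have args_eq : size (us ++ fill C u :: vs) = size (us ++ fill C v :: vs).
  by rewrite !size_cat.
(* [f] will be the identity for [sim_App] and [subst sigma] for [sim_U]. *)
have step ws (f : term F V -> term F V) :
    (forall i w', onth ws i = Some w' -> term_over sg (f w')) ->
    (forall i w' u', onth ws i = Some w' ->
      onth (us ++ fill C u :: vs) i = Some u' ->
      simulates (fun q => B (i :: q)) (f w') u') ->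
    forall i w' u', onth ws i = Some w' ->
      onth (us ++ fill C v :: vs) i = Some u' ->
    simulates (fun q => ev_update B (size us :: hole_pos C) l r (i :: q)) (f w') u'.
  move=> ws_ov sim i w' u' Hw /(@onth_update _ _ _ (fill C u))[[Ei ->]|[ne_i Hu]].
    subst i; apply: sim_sub (@ev_update_cons _ _ _ _ _) _.
    apply: IHC BC _; first exact: ws_ov Hw.
    by apply: sim Hw _; rewrite onth_cat ltnn subnn.
  by apply: sim_sub (sim _ _ _ Hw Hu) => q; apply: ev_update_neq.
move E: (App g _) sim_w => u0 sim_w; case: sim_w BC w_ov E step.
- by move=> B' w' u' B0 _ /B0.
- by [].
- move=> B' w' f ws us' wf ov sz sim BC _ [-> Eus] step.
  subst us'; rewrite args_eq in sz; apply: (sim_App wf ov sz).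
  apply: (step ws id) => // i x; by case/term_over_App: ov => _; apply.
- move=> B' w' rho i sigma us' Rrho Hi ov wl cs sz sim BC _ [-> Eus] step.
  subst us'; rewrite args_eq in sz; apply: (sim_U Rrho Hi ov wl cs sz).
  apply: (step _ (subst sigma)) => // n x Hx.
  by apply: subst_over_term ov _; apply: term_over_uargs Hx.
Qed.

(** * Instantiating and matching terms over F *)

Lemma sim_subst B sigma sigma' t : subst_over sg sigma' -> term_over sg t ->
    (forall p x, subterm t p = Some (Var x) ->
      simulates (fun q => B (p ++ q)) (sigma' x) (sigma x)) ->
  simulates B (subst sigma' t) (subst sigma (emb t)).
Proof.
move=> ov; elim/term_induction: t B => [x|f ts IHts] B t_ov sim.
  exact: (sim [::] x).
apply: (@sim_App _ _ _ (map (subst sigma') ts)).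
- exact: rt_refl.
- exact: (subst_over_term ov t_ov).
- by rewrite !size_map.
move=> i w' u'; rewrite !onth_map; case E: onth => [t|] //= -[<-] [<-].
apply: (IHts _ _ E); first by case/term_over_App: t_ov => _; apply; apply: E.
by move=> p x Hp; apply: (sim (i :: p)); rewrite /= E.
Qed.

(** [w] can be reduced until it matches: each argument of [t] gets its own substitution, and by
    linearity no variable is shared between arguments, so these glue into one. *)
Lemma sim_match t B sigma w : term_over sg t -> uniq (vars t) -> subst_over usg sigma ->
    term_over sg w -> simulates B w (subst sigma (emb t)) ->
  exists sigma', [/\ subst_over sg sigma', rsteps w (subst sigma' t) &
    forall p x, subterm t p = Some (Var x) ->
      simulates (fun q => B (p ++ q)) (sigma' x) (sigma x)].
Proof.
move=> t_ov Ut ov.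
elim/term_induction: t B w t_ov Ut => [x|f ts IHts] B w t_ov Ut w_ov sim_w.
  exists (fun _ => w); split=> //; first exact: rt_refl.
  by case=> [|//] y [<-].
move E: (subst _ _) sim_w => u sim_w; case: sim_w w_ov E.
- move=> B' w' u' B0 wu w_ov E; exists (erase x0 \o sigma); split.
  + exact: subst_over_erase.
  + by rewrite -erase_subst_emb E.
  + move=> p x _; apply: sim_extra; [by move=> q; apply: B0 | exact: rt_refl].
- by [].
- move=> B' w' f' ws us wf ws_ov sz sim w_ov [Ef Eus]; subst f'.
  have [Hf ws_ov'] := (term_over_App _ _ _).1 ws_ov.
  have [_ ts_ov] := (term_over_App _ _ _).1 t_ov.
  have sz_ts : size ws = size ts by rewrite sz -Eus !size_map.
  pose P i (h : V -> term F V) := forall t w',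
    onth ts i = Some t -> onth ws i = Some w' ->
    [/\ subst_over sg h, rsteps w' (subst h t) &
      forall p x, subterm t p = Some (Var x) ->
      simulates (fun q => B' (i :: p ++ q)) (h x) (sigma x)].
  have [g gP] : exists g, forall i, i < size ts -> P i (g i).
    apply: (finite_choice (@Var F V)) => i lt_i.
    move: (lt_i); rewrite -onthTE; case Et: onth => [t|] // _.
    move: (lt_i); rewrite -sz_ts -onthTE; case Ew: onth => [w1|] // _.
    have sim1 : simulates (fun q => B' (i :: q)) w1 (subst sigma (emb t)).
      by apply: sim Ew _; rewrite -Eus !onth_map Et.
    have [g gP] := IHts _ _ Et _ _ (ts_ov _ _ Et) (uniq_flatten_vars_onth Ut Et) (ws_ov' _ _ Ew) sim1.
    by exists g => t2 w2; rewrite Et Ew => -[<-] [<-].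
  (* [k x] is the only argument containing [x]. For a variable outside all arguments [find] returns
     [size ts], and [sigma'] defaults to [Var x]. *)
  pose k x := find (fun t => x \in vars t) ts.
  pose sigma' x := if k x < size ts then g (k x) x else Var x.
  have kE i t x : onth ts i = Some t -> x \in vars t -> k x = i.
    move=> Et xt; have has_x : has (fun t => x \in vars t) ts.
      apply/(has_nthP t); exists i; first by rewrite -onthTE Et.
      by rewrite (onth_nth _ _ _ _ Et).
    have := nth_find t has_x; have := has_x; rewrite has_find -onthTE -/(k x).
    case Ek: onth => [u1|] // _; rewrite (onth_nth _ _ _ _ Ek) => xu1.
    exact: uniq_flatten_vars_inj Ut Ek Et xu1 xt.
  have sigma'E i t : onth ts i = Some t -> {in vars t, g i =1 sigma'}.
    by move=> Et x xt; rewrite /sigma' (kE _ _ _ Et xt) -onthTE Et.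
  have onth_ws i t : onth ts i = Some t -> exists w1, onth ws i = Some w1.
    move=> Et; have : onth ws i by rewrite onthTE sz_ts -onthTE Et.
    by case: onth => // w1 _; exists w1.
  have lt_ts i t : onth ts i = Some t -> i < size ts by rewrite -onthTE => ->.
  have sigma'_ov : subst_over sg sigma'.
    move=> x; rewrite /sigma'; case: ifP => // lt_k.
    move: (lt_k); rewrite -onthTE; case Et: onth => [t|] // _.
    have [w1 Ew] := onth_ws _ _ Et.
    by have [] := gP _ lt_k _ _ Et Ew.
  exists sigma'; split=> //.
    apply: rt_trans wf _; apply: rsteps_App => //; first by rewrite size_map.
    move=> i w1 v Ew; rewrite onth_map; case Et: onth => [t|] //= -[<-].
    have [g_ov wt _] := gP _ (lt_ts _ _ Et) _ _ Et Ew.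
    rewrite -/(subst sigma' t) -(eq_subst_vars (sigma'E _ _ Et)); split=> //.
    exact: subst_over_term g_ov (ts_ov _ _ Et).
  case=> [|i p] x //=; case Et: onth => [t|] //= Hp.
  have [w1 Ew] := onth_ws _ _ Et.
  have [_ _ g_sim] := gP _ (lt_ts _ _ Et) _ _ Et Ew.
  rewrite -(sigma'E _ _ Et); first exact: g_sim.
  by apply/mem_vars; exists p.
- by [].
Qed.

(** The end of a reduction: the target has no [U] symbols, so the simulation unfolds symbol by
    symbol to [t] itself. *)
Lemma sim_App_rsteps B w t :
  term_over sg w -> term_over sg t -> simulates B w (emb t) -> rsteps w t.
Proof.
elim/term_induction: t B w => [x|f ts IHts] B w w_ov t_ov sim_w.
  by move E: (emb _) sim_w => u sim_w; case: sim_w w_ov E => // [B' w' u' _ wu _ E|? ? ? ? _ [->]] //; rewrite -E in wu.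
move E: (emb _) sim_w => u sim_w; case: sim_w w_ov E.
- by move=> B' w' u' _ wu _ E; rewrite -E erase_emb in wu.
- by [].
- move=> B' w' f' ws us wf ws_ov sz sim _ [Ef Eus]; subst f' us.
  have [_ ws_ov'] := (term_over_App _ _ _).1 ws_ov.
  have [_ ts_ov] := (term_over_App _ _ _).1 t_ov.
  apply: rt_trans wf _; apply: rsteps_App => //; first by rewrite sz size_map.
  move=> i w1 t Ew Et; split; last exact: ts_ov Et.
  apply: (IHts _ _ Et _ _ (ws_ov' _ _ Ew) (ts_ov _ _ Et)).
  by apply: sim Ew _; rewrite onth_map Et.
- by [].
Qed.

Lemma sim_refl t B : term_over sg t -> simulates B t (emb t).
Proof.
elim/term_induction: t B => [x|f ts IHts] B t_ov.
  by apply: sim_Var; apply: rt_refl.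
apply: (@sim_App _ _ _ ts) => //; first exact: rt_refl; first by rewrite size_map.
move=> i t u Et; rewrite onth_map Et /= => -[<-].
by apply: (IHts _ _ Et); case/term_over_App: t_ov => _; apply; apply: Et.
Qed.

(** * Root steps of the unraveled system *)

Lemma ev_update_var B l r pr q x :
    subterm r pr = Some (Var x) -> ev_update B [::] l r (pr ++ q) ->
  exists2 pl, subterm l pl = Some (Var x) & B (pl ++ q).
Proof.
(* The first clause fails since every position extends the root; the second, since no function
   position of [r] lies at or below a variable. In the third, the position determines [pr]. *)
move=> Hr [[_ ]|[q' [f [ts Hf]] Eq]|[pl [pr' [q' [[y Hl] lr Bq Eq]]]]].
  by rewrite prefix0s.
  by move: Hf; rewrite -[q']Eq => /(subterm_var_cat Hr)[].
rewrite /= in Bq Eq; rewrite Hl in lr.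
have [Epr Eq'] := var_pos_cat_inj Hr (esym lr) Eq; subst pr' q'.
by exists pl => //; rewrite Hl lr.
Qed.

(** By linearity a variable of [l] has a single position there, from which all allowed positions in
    its copies in [r] descend. An extra variable inherits none, so [sim_extra] applies. *)
Lemma sim_ev_update B l r sigma sigma' : linear l ->
    (forall p x, subterm l p = Some (Var x) ->
      simulates (fun q => B (p ++ q)) (sigma' x) (sigma x)) ->
    {in vars r, forall x, x \notin vars l -> sigma' x = erase x0 (sigma x)} ->
  forall p x, subterm r p = Some (Var x) ->
    simulates (fun q => ev_update B [::] l r (p ++ q)) (sigma' x) (sigma x).
Proof.
move=> lin_l sim extra p x Hp; have [xl|xNl] := boolP (x \in vars l).
  have [pl Hl] := (mem_vars _ _).1 xl; apply: sim_sub (sim pl x Hl) => q.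
  by case/(ev_update_var Hp) => pl' /(linear_var_pos_inj lin_l Hl) <-.
rewrite (extra x) //; last by apply/mem_vars; exists p.
apply: sim_extra; last exact: rt_refl.
by move=> q /(ev_update_var Hp)[pl Hl _]; case/negP: xNl; apply/mem_vars; exists pl.
Qed.

Lemma vars_uterm rho i t :
  vars (uterm lst rho i t) = vars t ++ lst (Zset rho i).
Proof.
rewrite /= vars_emb -map_comp; congr (_ ++ _).
by elim: (lst _) => //= x s ->.
Qed.

Lemma mem_lst_Zset rho i x :
  (x \in lst (Zset rho i)) = (x \in Xset rho i) && (x \in Yset rho i).
Proof. by rewrite (lst_listing _).2 inE. Qed.

Lemma sim_uterm B sigma sigma' w rho i :
    R rho -> 1 <= i <= size (conds rho) -> subst_over sg sigma' ->
    rsteps w (subst sigma' (lhs rho)) ->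
    (forall j, 1 <= j < i ->
      rsteps (subst sigma' (cond_l rho j)) (subst sigma' (cond_r rho j))) ->
    (forall p x, subterm (uterm lst rho i (cond_l rho i)) p = Some (Var x) ->
      simulates (fun q => B (p ++ q)) (sigma' x) (sigma x)) ->
  simulates B w (subst sigma (uterm lst rho i (cond_l rho i))).
Proof.
move=> Rrho Hi ov wl cs sim; apply: (sim_U Rrho Hi ov wl cs).
  by rewrite /= !size_map.
case=> [|n] w' u' /=.
  case=> <- [<-]; apply: sim_subst => //; first by case: (term_over_cond Rrho Hi).
  by move=> p x Hp; apply: (sim (0 :: p)); rewrite /= subterm_emb_var.
rewrite !onth_map; case E: onth => [x|] //= -[<-] [<-].
by apply: (sim [:: n.+1]); rewrite /= onth_map E.
Qed.

(** Matching determines only the variables of [t]; all others are sent to the erasure of their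
    instance, so that one [sigma'] also serves a right-hand side with extra variables. *)
Lemma sim_emb_match B sigma w t : term_over sg t -> linear t ->
    subst_over usg sigma -> term_over sg w -> simulates B w (subst sigma (emb t)) ->
  exists sigma', [/\ subst_over sg sigma', rsteps w (subst sigma' t),
    (forall p x, subterm (emb t) p = Some (Var x) ->
      simulates (fun q => B (p ++ q)) (sigma' x) (sigma x)) &
    forall x, x \notin vars (emb t) -> sigma' x = erase x0 (sigma x)].
Proof.
move=> t_ov lin_t ov w_ov /(sim_match t_ov lin_t ov w_ov)[tau [tau_ov wt sim]].
exists (fun x => if x \in vars t then tau x else erase x0 (sigma x)); split.
- by move=> x; case: ifP => // _; apply: subst_over_erase.
- by rewrite -(@eq_subst_vars _ _ tau) // => x ->.
- move=> p x /subterm_emb_var Hp; case: ifP => [_|/negP[]]; first exact: sim.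
  by apply/mem_vars; exists p.
- by move=> x; rewrite vars_emb => /negbTE->.
Qed.

(** The substitution [tau] stored in the [U] term is kept on X_i, since matching against t_i binds
    only variables outside X_i. The conditions established earlier mention only variables of X_i and
    survive. *)
Lemma sim_uterm_match B sigma w rho i : linear (uterm lst rho i (cond_r rho i)) ->
    subst_over usg sigma -> term_over sg w -> B [::] ->
    simulates B w (subst sigma (uterm lst rho i (cond_r rho i))) ->
  exists sigma', [/\ subst_over sg sigma', rsteps w (subst sigma' (lhs rho)),
    (forall j, 1 <= j <= i ->
      rsteps (subst sigma' (cond_l rho j)) (subst sigma' (cond_r rho j))),
    (forall p x, subterm (uterm lst rho i (cond_r rho i)) p = Some (Var x) ->
      simulates (fun q => B (p ++ q)) (sigma' x) (sigma x)) &
    forall x, x \in Yset rho i -> x \notin vars (uterm lst rho i (cond_r rho i)) ->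
      sigma' x = erase x0 (sigma x)].
Proof.
rewrite /linear vars_uterm cat_uniq => /and3P[Ut disj Uz] ov w_ov B0 sim_w.
(* A permitted root step rules out an extra instance, and the root symbol leaves only [sim_U]. *)
move E: (subst _ _) sim_w => u sim_w; case: sim_w w_ov B0 E.
- by move=> B' w' u' BF _ _ /BF.
- by [].
- by [].
move=> B' w' rho' i' tau us Rrho Hi tau_ov wl cs sz sim w_ov B0 [Erho Ei Eus].
subst rho' i'; have [s_ov t_ov] := term_over_cond Rrho Hi.
have sim_s : simulates (fun q => B' (0 :: q)) (subst tau (cond_l rho i))
    (subst sigma (emb (cond_r rho i))).
  by apply: sim; rewrite -?Eus.
have [tau2 [tau2_ov st sim_t]] :=
  sim_match t_ov Ut ov (subst_over_term tau_ov s_ov) sim_s.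
pose sigma' x := if x \in vars (cond_r rho i) then tau2 x
  else if x \in Xset rho i then tau x else erase x0 (sigma x).
(* As Y_i contains Var(t_i), a variable of t_i in X_i is in Z_i and would occur twice in
   U^rho_i(t_i, Z_i). *)
have XNt x : x \in Xset rho i -> x \notin vars (cond_r rho i).
  move=> xX; apply/negP=> xt; case/hasP: disj; exists x => //.
  by rewrite mem_lst_Zset xX cond_r_Yset.
have sigma'X x : x \in Xset rho i -> tau x = sigma' x.
  by move=> xX; rewrite /sigma' (negbTE (XNt _ xX)) xX.
(* Determinism puts Var(s_j) inside X_j, and X_j grows with j. *)
have sX j x : 1 <= j <= i -> x \in vars (cond_l rho j) -> x \in Xset rho i.
  case/andP=> j_gt0 le_ji xs; apply: (Xset_sub le_ji).
  have Hj : 1 <= j <= size (conds rho).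
    by rewrite j_gt0; case/andP: Hi => _; apply: leq_trans.
  have /fsubsetP sub := R_det Rrho Hj; apply: sub.
  by rewrite mem_Vars /= cats0.
exists sigma'; split.
- move=> x; rewrite /sigma'; do 2?[case: ifP => // _].
  exact: subst_over_erase.
- rewrite -(@eq_subst_vars _ _ tau sigma') // => x xl; apply: sigma'X; exact: lhs_Xset.
- move=> j Hj; rewrite -(@eq_subst_vars _ _ tau sigma' (cond_l rho j)); last first.
    by move=> x xs; apply: sigma'X; apply: sX xs.
  case/andP: Hj => j_gt0; rewrite leq_eqVlt => /predU1P[->|lt_ji].
    by rewrite -(@eq_subst_vars _ _ tau2 sigma') // => x; rewrite /sigma' => ->.
  rewrite -(@eq_subst_vars _ _ tau sigma' (cond_r rho j)).
    by apply: cs; rewrite j_gt0.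
  move=> x xt; apply: sigma'X; apply: cond_r_Xset xt; first by rewrite j_gt0.
  by case/andP: Hi.
(* Position 0 leads into t_i, position n+1 to entry n of the listing of Z_i. *)
- move=> [|[|n] p] x //=.
    move=> /subterm_emb_var Hp; rewrite /sigma' ifT; first exact: sim_t.
    by apply/mem_vars; exists p.
  rewrite onth_map; case Ex: onth => [y|] //=; case: p => [|//] [<-].
  have : y \in lst (Zset rho i) by apply/onthP; exists n.
  rewrite mem_lst_Zset => /andP[yX _]; rewrite -sigma'X //=.
  by apply: (sim n.+1 (Var y)); rewrite -?Eus /= !onth_map Ex.
- move=> x xY; rewrite mem_cat negb_or mem_lst_Zset xY andbT.
  by case/andP=> /negbTE xt /negbTE xX; rewrite /sigma' xt xX.
Qed.

(** Rules that create or advance a [U] symbol leave [w] in place and renew only the stored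
    substitution. An unconditional rule, or the last rule of a chain, makes [w] reduce by [rho]
    itself. *)
Lemma sim_Uopt_root l r sigma B w :
    Uopt lst R (Rule l r [::]) -> subst_over usg sigma -> term_over sg w ->
    B [::] -> simulates B w (subst sigma l) ->
  simulates (ev_update B [::] l r) w (subst sigma r).
Proof.
move=> Ur ov w_ov B0; have /= := R_LL Ur; case: Ur => rho Rrho.
have [l_ov r_ov _] := R_over Rrho.
have lin_emb (t : term F V) : linear (emb t) -> linear t by rewrite /linear vars_emb.
move E: (Rule l r [::]) => rl Hrl; case: Hrl E.
- move=> k0 [-> ->] lin_l sim_w.
  have [sigma' [ov' wl sim extra]] := sim_emb_match l_ov (lin_emb _ lin_l) ov w_ov sim_w.
  apply: (@sim_rsteps _ _ (subst sigma' (rhs rho))).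
    apply: rt_trans wl _; apply: rsteps_rule => //.
    by rewrite (size0nil k0); apply: List.Forall_nil.
  apply: sim_subst => // p x /subterm_emb_var Hp.
  by apply: (sim_ev_update lin_l sim) Hp => y _; apply: extra.
- move=> k_gt0 [-> ->] lin_l sim_w.
  have [sigma' [ov' wl sim extra]] := sim_emb_match l_ov (lin_emb _ lin_l) ov w_ov sim_w.
  apply: (sim_uterm Rrho) => //; first by case.
  by apply: (sim_ev_update lin_l sim) => y _; apply: extra.
- move=> i Hi [-> ->] lin_l sim_w.
  have [sigma' [ov' wl cs sim extra]] := sim_uterm_match lin_l ov w_ov B0 sim_w.
  apply: (sim_uterm Rrho) => //; first by case/andP: Hi.
  apply: (sim_ev_update lin_l sim) => y; rewrite vars_uterm mem_cat mem_lst_Zset => yr.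
  apply: extra; apply: YsetS => //; by case/orP: yr => [->|/andP[_ ->]] //; rewrite orbT.
- move=> k_gt0 [-> ->] lin_l sim_w.
  have [sigma' [ov' wl cs sim extra]] := sim_uterm_match lin_l ov w_ov B0 sim_w.
  apply: (@sim_rsteps _ _ (subst sigma' (rhs rho))).
    apply: rt_trans wl _; apply: rsteps_rule => //.
    exact: (Forall_conds (P := fun s t => rsteps (subst sigma' s) (subst sigma' t))).
  apply: sim_subst => // p x /subterm_emb_var Hp.
  apply: (sim_ev_update lin_l sim) Hp => y; rewrite vars_emb => yr.
  by apply: extra; apply: rhs_Yset.
Qed.

Lemma sim_evs_from B u v w : evs_from usg (Uopt lst R) B u v ->
  term_over sg w -> simulates B w u -> exists B', simulates B' w v.
Proof.
move=> red w_ov; elim: red => {B u v} [B t sim_w|B l r C sigma t Ur _ ov BC _ IH sim_w].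
  by exists B.
apply: IH; apply: sim_fill BC sim_w => // B' w' w'_ov B0.
exact: sim_Uopt_root.
Qed.

End Soundness.

Theorem theorem4p17 (F : Type) (ar : F -> nat) (V : countType)
    (V_infinite : forall X : {fset V}, exists x : V, x \notin X)
    (lst : {fset V} -> seq V) (lst_listing : is_listing lst)
    (R : eCTRS F V)
    (R_over : eCTRS_over (arity_sig ar) R)
    (R_det : deterministic R)
    (R_LL : Uopt_LL lst R)
    (R_LV_RV : nonLV R \/ nonRV R) :
  forall s t : term F V,
    term_over (arity_sig ar) s -> term_over (arity_sig ar) t ->
    evsteps (Uopt_sig lst (arity_sig ar) R) (Uopt lst R) (emb s) (emb t) ->
    rsteps (arity_sig ar) R s t.
Proof.
(* [x0] is the variable that [erase] puts in place of [U]-rooted subterms. *)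
move=> s t s_ov t_ov red; have [x0 _] := V_infinite fset0.
have [B sim_st] := sim_evs_from lst_listing R_over R_det R_LL red s_ov
  (sim_refl lst R x0 (fpos (emb s)) s_ov).
exact: sim_App_rsteps sim_st.
Qed.
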